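(* There is a universal constant $K>0$ such that the following holds. Let $N,d,C\in\mathbb{N}$ with $N\ge 2$, let $r\ge 1$ and $0<\delta\le 1$, and let $(\mathbf{x}_1,y_1),\dots,(\mathbf{x}_N,y_N)\in\mathbb{R}^d\times\{1,\dots,C\}$ be a set of $N$ labeled samples with $\|\mathbf{x}_i\|\le r$ for every $i$ and $\|\mathbf{x}_i-\mathbf{x}_j\|\ge\delta$ for every $i\ne j$. Denote $R:=10rN^2\delta^{-1}\sqrt{\pi d}$. Then there exists a ReLU neural network $F:\mathbb{R}^d\to\mathbb{R}$ with width $12$, depth at most $$K\left(\sqrt{N\log(N)}+\sqrt{\frac{N}{\log(N)}}\cdot\max\{\log(R),\log(C)\}\right),$$ and bit complexity at most $$K\left(\log(d)+\sqrt{\frac{N}{\log(N)}}\cdot\max\{\log(R),\log(C)\}\right),$$ such that $F(\mathbf{x}_i)=y_i$ for every $i\in\{1,\dots,N\}$.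
   Context: $\|\cdot\|$ is the Euclidean norm and $\log$ is the base-2 logarithm. $\sigma(z)=\max\{0,z\}$ is the ReLU function, applied coordinatewise to vectors. A ReLU neural network of depth $L$ is a function $\mathcal{N}:\mathbb{R}^d\to\mathbb{R}$ computed by $\mathbf{h}^{(1)}=\sigma(W^{(1)}\mathbf{x}+\mathbf{b}^{(1)})$ with $W^{(1)}\in\mathbb{R}^{m_1\times d}$, $\mathbf{b}^{(1)}\in\mathbb{R}^{m_1}$; $\mathbf{h}^{(i)}=\sigma(W^{(i)}\mathbf{h}^{(i-1)}+\mathbf{b}^{(i)})$ with $W^{(i)}\in\mathbb{R}^{m_i\times m_{i-1}}$, $\mathbf{b}^{(i)}\in\mathbb{R}^{m_i}$ for $i=2,\dots,L-1$; and $\mathcal{N}(\mathbf{x})=W^{(L)}\mathbf{h}^{(L-1)}+\mathbf{b}^{(L)}$ with $W^{(L)}\in\mathbb{R}^{1\times m_{L-1}}$, $\mathbf{b}^{(L)}\in\mathbb{R}$. Its width is $\max\{m_1,\dots,m_{L-1}\}$. The bit complexity of a weight (an entry of some $W^{(i)}$ or $\mathbf{b}^{(i)}$) is the number of bits required to represent it: for $n\in\mathbb{N}$ it is $\lceil\log n\rceil$, and for a non-integer weight with a finite binary expansion it is the number of binary digits before and after the binary point (leading zeros of the integer part not counted), signs being disregarded. Only weights of finite bit complexity are used. The bit complexity of the network is the maximal bit complexity of its weights. *)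

(* Defs.v *)
From mathcomp Require Import all_boot all_order all_algebra.
From mathcomp Require Import all_classical all_reals all_analysis.

Set Implicit Arguments.
Unset Strict Implicit.
Unset Printing Implicit Defensive.

Import Order.TTheory GRing.Theory Num.Theory.

Local Open Scope ring_scope.

Definition log2 (R : realType) (t : R) : R := ln t / ln 2.

(* The library norm `|x| on matrices is the sup norm. *)
Definition enorm (R : realType) (d : nat) (x : 'cV[R]_d) : R :=
  Num.sqrt (\sum_(i < d) x i 0 ^+ 2).

Definition relu (R : realType) (m : nat) (v : 'cV[R]_m) : 'cV[R]_m :=
  map_mx (Num.max 0) v.

(* A network of depth L with input dimension n is L - 1 [Hidden] layers, first
   layer outermost, followed by the affine [Output] layer.  A bare [Output] has
   depth 1 and width 0; a network of positive width has depth at least 2. *)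
Inductive relu_net (R : realType) (n : nat) : Type :=
| Output (W : 'M[R]_(1, n)) (b : R)
| Hidden (m : nat) (W : 'M[R]_(m, n)) (b : 'cV[R]_m) (F : relu_net R m).

Fixpoint net_eval (R : realType) (n : nat) (F : relu_net R n) : 'cV[R]_n -> R :=
  match F with
  | Output W b => fun x => (W *m x) 0 0 + b
  | Hidden m W b G => fun x => net_eval G (relu (W *m x + b))
  end.

Fixpoint net_depth (R : realType) (n : nat) (F : relu_net R n) : nat :=
  match F with
  | Output _ _ => 1
  | Hidden _ _ _ G => (net_depth G).+1
  end.

Fixpoint net_width (R : realType) (n : nat) (F : relu_net R n) : nat :=
  match F with
  | Output _ _ => 0
  | Hidden m _ _ G => maxn m (net_width G)
  end.

Definition mx_entries (R : realType) (m n : nat) (A : 'M[R]_(m, n)) : seq R :=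
  [seq A i j | i <- enum 'I_m, j <- enum 'I_n].

Fixpoint net_weights (R : realType) (n : nat) (F : relu_net R n) : seq R :=
  match F with
  | Output W b => rcons (mx_entries W) b
  | Hidden m W b G => mx_entries W ++ mx_entries b ++ net_weights G
  end.

Definition finite_binary (R : realType) (w : R) : Prop :=
  exists k : nat, w * 2 ^+ k \is a Num.int.

(* Number of binary digits of n without leading zeros; 0 has none. *)
Definition int_digits (n : nat) : nat :=
  if n == 0%N then 0%N else (trunc_log 2 n).+1.

(* Number of binary digits after the binary point (0 is a junk value when the
   expansion is infinite). *)
Definition frac_digits (R : realType) (w : R) : nat :=
  match pselect (finite_binary w) with
  | left e => ex_minn e
  | right _ => 0%N
  end.

(* [up_log 2 n] is the ceiling of the base-2 logarithm of n > 0, and is 0 for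
   n = 0.  Meaningful only when [finite_binary w]. *)
Definition weight_bits (R : realType) (w : R) : nat :=
  let n := Num.truncn `|w| in
  if w \is a Num.int then up_log 2 n
  else (int_digits n + frac_digits w)%N.

Definition finite_bit_complexity (R : realType) (n : nat) (F : relu_net R n) :
    Prop :=
  forall w : R, w \in net_weights F -> finite_binary w.

Definition bit_complexity (R : realType) (n : nat) (F : relu_net R n) : nat :=
  \max_(w <- net_weights F) weight_bits w.

(* Main.v *)
Require Import Defs.
From mathcomp Require Import all_boot all_order all_algebra.
From mathcomp Require Import all_classical all_reals all_analysis.
From mathcomp Require Import ring lra zify.

Set Implicit Arguments.
Unset Strict Implicit.
Unset Printing Implicit Defensive.

Import Order.TTheory GRing.Theory Num.Theory.

Local Open Scope ring_scope.

(* All weights of the network are integers, so that its bit complexity is at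
   most B as soon as every weight is at most 2^B in absolute value.

   The samples are first mapped to points z_i >= 0 of the line at mutual
   distance at least 2, by an integer vector u with entries at most N^2: for
   each pair of samples, at most one value of a suitable coordinate of u brings
   the two projections too close, so a union bound provides u.  The point z_i is
   then identified by its key, the integer part of z_i.

   The samples, sorted by z, are cut into m ~ sqrt(N log N) groups of
   n ~ sqrt(N / log N) consecutive ones.  The keys and the labels of a group,
   with b bits each, b = O(max(log R, log C)), are the digits of one integer
   below 2^(2bn).  A chain of m ramps selects the integer of the group of z;
   its bits are then peeled off from the top in O(nb) layers, and each label
   is added to the output if the key before it matches z. *)

(** * Layers acting on a bank of twelve registers *)

Section RegisterMachine.
Variable R : realType.
Implicit Types (s r : seq R) (L : seq (seq R * R)) (p : seq (seq (seq R * R))).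

(** A neuron is a list of coefficients with a bias; missing trailing coefficients count as 0, so a
    row stops at the last register it reads. *)
Fixpoint dot r s : R :=
  match r, s with a :: r', x :: s' => a * x + dot r' s' | _, _ => 0 end.

Definition layer_eval L s : seq R :=
  [seq Num.max 0 (dot f.1 s + f.2) | f <- L].

Definition run p s : seq R := foldl (fun t L => layer_eval L t) s p.

Lemma run_cat p q s : run (p ++ q) s = run q (run p s).
Proof. exact: foldl_cat. Qed.

Definition regs s : 'cV[R]_12 := \col_i s`_i.
Definition layer_mx L : 'M[R]_12 :=
  \matrix_(i, j) (nth ([::], 0) L i).1`_j.
Definition layer_bias L : 'cV[R]_12 := \col_i (nth ([::], 0) L i).2.

(** All layers are padded with zero neurons to width 12; the output is read from register 2, where
    the programs accumulate the label. *)
Fixpoint net_of p : relu_net R 12 :=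
  match p with
  | [::] => Output (\row_j (j == 2 :> nat)%:R) 0
  | L :: p' => Hidden (layer_mx L) (layer_bias L) (net_of p')
  end.

Lemma sum_dot r s n : (size s <= n)%N -> \sum_(j < n) r`_j * s`_j = dot r s.
Proof.
elim: s r n => [|x s IH] [|a r] n /= hn.
- by rewrite big1 // => j _; rewrite nth_nil mul0r.
- by rewrite big1 // => j _; rewrite nth_nil mulr0.
- by rewrite big1 // => j _; rewrite nth_nil mul0r.
- by case: n hn => [//|n] hn; rewrite big_ord_recl /= -(IH r n).
Qed.

Lemma relu_layer L s : (size L <= 12)%N -> (size s <= 12)%N ->
  relu (layer_mx L *m regs s + layer_bias L) = regs (layer_eval L s).
Proof.
move=> hL hs; apply/matrixP => i j; rewrite !mxE.
under eq_bigr do rewrite !mxE.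
rewrite (sum_dot _ hs) /layer_eval.
have [iL|iL] := ltnP i (size L); first by rewrite (nth_map ([::], 0)).
by rewrite !nth_default ?size_map //= addr0 maxxx.
Qed.

Lemma net_of_eval p s : all (fun L => size L <= 12)%N p -> (size s <= 12)%N ->
  net_eval (net_of p) (regs s) = (run p s)`_2.
Proof.
elim: p s => [|L p IH] s /= hp hs.
  rewrite mxE addr0 (bigD1 (inord 2 : 'I_12)) //= big1 => [|i].
    by rewrite !mxE inordK // eqxx mul1r addr0.
  rewrite -val_eqE /= inordK // => /negbTE i2.
  by rewrite !mxE i2 mul0r.
case/andP: hp => hL hp.
by rewrite relu_layer // IH // size_map.
Qed.

Lemma net_of_depth p : net_depth (net_of p) = (size p).+1.
Proof. by elim: p => //= L p ->. Qed.

Lemma net_of_width p : (net_width (net_of p) <= 12)%N.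
Proof. by elim: p => //= L p IH; rewrite geq_max IH. Qed.

(** * Size of the weights *)

Definition bounded_int (B : nat) (w : R) :=
  (w \is a Num.int) && (`|w| <= 2 ^+ B).

Definition bounded_layer B L :=
  (size L <= 12)%N && all (fun f => all (bounded_int B) (f.2 :: f.1)) L.

Lemma bounded_int_sub B m n : (m <= 2 ^ B)%N -> (n <= 2 ^ B)%N ->
  bounded_int B (m%:R - n%:R).
Proof.
move=> hm hn; apply/andP; split; first by rewrite rpredB ?natr_int.
rewrite -natrX; move: hm hn; rewrite -!(ler_nat R) => hm hn.
have hm0 := ler0n R m; have hn0 := ler0n R n.
by rewrite ler_norml; apply/andP; split; lra.
Qed.

Lemma bounded_int_nat B m : (m <= 2 ^ B)%N -> bounded_int B m%:R.
Proof. by move=> hm; rewrite -[m%:R]subr0; apply: (@bounded_int_sub _ _ 0). Qed.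

Lemma bounded_int_opp B m : (m <= 2 ^ B)%N -> bounded_int B (- m%:R).
Proof. by move=> hm; rewrite -[- _]sub0r; apply: (@bounded_int_sub _ 0). Qed.

Lemma bounded_int0 B : bounded_int B 0.
Proof. exact: (@bounded_int_nat _ 0). Qed.

Lemma bounded_int1 B : bounded_int B 1.
Proof. by apply: (@bounded_int_nat _ 1); rewrite expn_gt0. Qed.

Lemma bounded_intN1 B : bounded_int B (- 1).
Proof. by apply: (@bounded_int_opp _ 1); rewrite expn_gt0. Qed.

Lemma bounded_int_finite B w : bounded_int B w -> finite_binary w.
Proof. by case/andP => hw _; exists 0%N; rewrite expr0 mulr1. Qed.

(** [up_log] is a ceiling, so an integer of absolute value exactly 2^B still has only B bits. *)
Lemma bounded_int_bits B w : bounded_int B w -> (weight_bits w <= B)%N.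
Proof.
case/andP => hw hB; rewrite /weight_bits hw.
rewrite -[leqRHS](@up_expnK 2) //; apply: leq_up_log.
by rewrite -(ler_nat R) natrX (le_trans _ hB) // truncn_le.
Qed.

Lemma mx_entriesP m n (A : 'M[R]_(m, n)) w :
  w \in mx_entries A -> exists i j, w = A i j.
Proof. by case/allpairsP => -[i j] [_ _ ->]; exists i, j. Qed.

Lemma net_of_weights B p : all (bounded_layer B) p ->
  forall w, w \in net_weights (net_of p) -> bounded_int B w.
Proof.
elim: p => [_ w|L p IH /= /andP[hL hp] w].
  rewrite /= mem_rcons inE => /predU1P[->|]; first exact: bounded_int0.
  by case/mx_entriesP => i [j ->]; rewrite mxE; case: eqP => _;
    [exact: bounded_int1 | exact: bounded_int0].
have hrow k : all (bounded_int B)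
    ((nth ([::], 0) L k).2 :: (nth ([::], 0) L k).1).
  have [kL|kL] := ltnP k (size L); last by rewrite nth_default //= bounded_int0.
  by case/andP: hL => _ /allP; apply; rewrite mem_nth.
rewrite !mem_cat => /or3P[| |/IH]; last exact.
- case/mx_entriesP => i [j ->]; rewrite mxE; case/andP: (hrow i) => _ /allP hi.
  have [jl|jl] := ltnP j (size (nth ([::], 0) L i).1).
    by apply: hi; rewrite mem_nth.
  by rewrite nth_default // bounded_int0.
- by case/mx_entriesP => i [j ->]; rewrite mxE; case/andP: (hrow i).
Qed.

(** The projection of the input goes to register 0; the other eleven neurons output 0 and make the
    width exactly 12. *)
Definition input_net d (v : 'I_d -> R) (beta : R) p : relu_net R d :=
  Hidden (\matrix_(i < 12, j < d) (if i == 0 then v j else 0))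
    (\col_(i < 12) (if i == 0 then beta else 0)) (net_of p).

Lemma input_net_width d (v : 'I_d -> R) beta p :
  net_width (input_net v beta p) = 12%N.
Proof. by apply/maxn_idPl/net_of_width. Qed.

Lemma input_net_depth d (v : 'I_d -> R) beta p :
  net_depth (input_net v beta p) = (size p).+2.
Proof. by rewrite /= net_of_depth. Qed.

Lemma input_net_weights B d (v : 'I_d -> R) beta p :
  (forall j, bounded_int B (v j)) -> bounded_int B beta ->
  all (bounded_layer B) p ->
  forall w, w \in net_weights (input_net v beta p) -> bounded_int B w.
Proof.
move=> hv hb hp w; rewrite !mem_cat => /or3P[| |].
- by case/mx_entriesP => i [j ->]; rewrite mxE; case: ifP; rewrite ?bounded_int0.
- by case/mx_entriesP => i [j ->]; rewrite mxE; case: ifP; rewrite ?bounded_int0.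
- exact: net_of_weights.
Qed.

Lemma bounded_weights_bits B d (F : relu_net R d) :
  (forall w, w \in net_weights F -> bounded_int B w) ->
  finite_bit_complexity F /\ (bit_complexity F <= B)%N.
Proof.
move=> hF; split=> [w /hF|]; first exact: bounded_int_finite.
by rewrite /bit_complexity; apply/bigmax_leqP_seq => w /hF hw _;
  exact: bounded_int_bits.
Qed.

Lemma input_net_eval B d (v : 'I_d -> R) beta p (x : 'cV[R]_d) :
  all (bounded_layer B) p -> 0 <= \sum_j v j * x j 0 + beta ->
  net_eval (input_net v beta p) x = (run p [:: \sum_j v j * x j 0 + beta])`_2.
Proof.
move=> hp hz; rewrite /= -net_of_eval //; last first.
  by apply: sub_all hp => L /andP[].
congr net_eval; apply/matrixP => i j; rewrite !mxE.
have [->|i0] := eqVneq i 0.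
  rewrite (eq_bigr (fun k => v k * x k 0)) ?max_r // => k _.
  by rewrite mxE ord1.
rewrite big1 => [|k _]; last by rewrite mxE (negbTE i0) mul0r.
rewrite addr0 maxxx; case: i i0 => -[//|i] ? _.
by rewrite /= nth_nil.
Qed.

End RegisterMachine.

(** * Programs for bits, keys, labels and the selection of a group *)

Section Programs.
Variable R : realType.
Implicit Types (z a t : R) (s : seq (nat * nat)).

Lemma max0n (n : nat) : Num.max 0 n%:R = n%:R :> R.
Proof. exact/max_r/ler0n. Qed.

(** The difference of two ReLUs is the unit step at k, except between k - 1 and k, where it climbs
    linearly; integers and suitably separated points avoid this gap. *)
Lemma ramp_sub (k : nat) z : z <= k%:R - 1 \/ k%:R <= z ->
  Num.max 0 (z + (1 - k%:R)) - Num.max 0 (z - k%:R) = (k%:R <= z)%R%:R.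
Proof.
case: (lerP k%:R z) => [kz _|zk [] h]; last lra.
- by rewrite /= !max_r; lra.
- by rewrite /= !max_l; lra.
Qed.

(* Registers: the point, the undecoded part of the encoding, the output so far,
   the match flag of the last key, and the digit being assembled. *)
Definition extract_bit (P : nat) : seq (seq (seq R * R)) :=
  [:: [:: ([:: 1], 0); ([:: 0; 1], 0); ([:: 0; 0; 1], 0);
          ([:: 0; 0; 0; 1], 0); ([:: 0; 0; 0; 0; 1], 0);
          ([:: 0; 1], 1 - P%:R); ([:: 0; 1], - P%:R)];
      [:: ([:: 1], 0); ([:: 0; 1; 0; 0; 0; - P%:R; P%:R], 0);
          ([:: 0; 0; 1], 0); ([:: 0; 0; 0; 1], 0);
          ([:: 0; 0; 0; 0; 2; 1; -1], 0)]].

(** As u < 2P, the quotient of u by P is a single bit, which the ramp computes exactly because u is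
    an integer. *)
Lemma run_extract_bit P z (u : nat) a t (k : nat) :
  0 <= z -> 0 <= a -> 0 <= t -> (u < P.*2)%N ->
  run (extract_bit P) [:: z; u%:R; a; t; k%:R] =
  [:: z; (u %% P)%:R; a; t; (k.*2 + u %/ P)%:R].
Proof.
move=> z0 a0 t0 uP.
rewrite /run /layer_eval /=; rewrite !(mul1r, mul0r, addr0, add0r) mulN1r.
have := @ramp_sub P u%:R; move: (Num.max 0 _) (Num.max 0 _) => p q.
have hk : u%:R <= P%:R - 1 :> R \/ P%:R <= u%:R :> R.
  rewrite ler_nat; case: (leqP P u) => [|uP']; [by right | left].
  by rewrite lerBrDr natr1 ler_nat.
(* The first ramp becomes the bit plus the second ramp [p], which then cancels in both registers. *)
move=> /(_ hk); rewrite ler_nat => /eqP; rewrite subr_eq => /eqP ->.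
have -> : (u %/ P)%N = (P <= u)%N.
  case: leqP => Pu; last by rewrite divn_small.
  have P0 : (0 < P)%N by case: P uP {hk Pu}.
  by rewrite -(subnK Pu) divnDr // divnn P0 divn_small //; lia.
have -> : (u %% P)%N = (u - P * (P <= u))%N.
  case: leqP => Pu; last by rewrite muln0 subn0 modn_small.
  by rewrite muln1 -{1}(subnK Pu) modnDr modn_small //; lia.
have -> : Num.max 0 u%:R + (1 *- P * ((P <= u)%:R + p) + P%:R * p)
    = u%:R - (P * (P <= u))%:R.
  by rewrite max_r // natrM; ring.
have e : (P * (P <= u) <= u)%N by case: leqP; lia.
rewrite addrK -natrB // !(max0n, max_r z0, max_r a0, max_r t0).
by rewrite -natrM -natrD max0n mul2n.
Qed.

(** [T] counts the low bits left undecoded; the b bits above them are peeled off from the top. *)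
Fixpoint extract_digit (T b : nat) : seq (seq (seq R * R)) :=
  if b is b'.+1 then extract_bit (2 ^ (T + b')) ++ extract_digit T b' else [::].

Lemma run_extract_digit T b z (u : nat) a t (k : nat) :
  0 <= z -> 0 <= a -> 0 <= t -> (u < 2 ^ (T + b))%N ->
  run (extract_digit T b) [:: z; u%:R; a; t; k%:R] =
  [:: z; (u %% 2 ^ T)%:R; a; t; (k * 2 ^ b + u %/ 2 ^ T)%:R].
Proof.
move=> z0 a0 t0; elim: b u k => [|b IH] u k hu.
  rewrite addn0 in hu.
  by rewrite /= muln1 modn_small // divn_small // addn0.
have P0 : (0 < 2 ^ (T + b))%N by rewrite expn_gt0.
rewrite run_cat run_extract_bit //; last by rewrite -mul2n -expnS -addnS.
rewrite IH ?ltn_pmod // modn_dvdm ?dvdn_exp2l ?leq_addr //.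
congr [:: _; _; _; _; _%:R].
(* Split u at its top bit: q joins the assembled digit, r is left to the remaining passes. *)
have {3}-> := divn_eq u (2 ^ (T + b)).
move: (u %/ _)%N (u %% _)%N => q r.
by rewrite [in RHS]expnD [(_ ^ T * _)%N]mulnC mulnA divnMDl ?expn_gt0 // expnS;
  lia.
Qed.

Lemma run_extract_leading_digit T b z (u v : nat) a t : 0 <= z -> 0 <= a ->
  0 <= t -> (u < 2 ^ b)%N -> (v < 2 ^ T)%N ->
  run (extract_digit T b) [:: z; (u * 2 ^ T + v)%:R; a; t; 0] =
  [:: z; v%:R; a; t; u%:R].
Proof.
move=> z0 a0 t0 ub vT; rewrite -[X in [:: _; _; _; _; X]](mulr0n 1).
have P0 : (0 < 2 ^ T)%N by rewrite expn_gt0.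
rewrite run_extract_digit //.
  by rewrite modnMDl divnMDl // modn_small // divn_small // mul0n addn0.
rewrite expnD mulnC; move: (2 ^ T)%N (2 ^ b)%N P0 ub vT => P Q *.
by apply: (@leq_trans (u.+1 * P)); [lia | rewrite mulnC leq_mul2l; lia].
Qed.

(** One minus the distance from z to the interval [k, k+1], cut off at 0: a trapezoid. *)
Definition hit z (k : nat) : R :=
  Num.max 0 (1 - (Num.max 0 (k%:R - z) + Num.max 0 (z - k%:R - 1))).

(** The first layer puts the overshoots of z on either side of [k, k+1] in place of the old flag and
    the key; the digit register ends at 0, ready for the label. *)
Definition test_key : seq (seq (seq R * R)) :=
  [:: [:: ([:: 1], 0); ([:: 0; 1], 0); ([:: 0; 0; 1], 0);
          ([:: -1; 0; 0; 0; 1], 0); ([:: 1; 0; 0; 0; -1], -1)];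
      [:: ([:: 1], 0); ([:: 0; 1], 0); ([:: 0; 0; 1], 0);
          ([:: 0; 0; 0; -1; -1], 1); ([::], 0)]].

Lemma run_test_key z (u : nat) a t (k : nat) : 0 <= z -> 0 <= a ->
  run test_key [:: z; u%:R; a; t; k%:R] = [:: z; u%:R; a; hit z k; 0].
Proof.
move=> z0 a0; rewrite /run /layer_eval /=.
rewrite !(mul1r, mul0r, addr0, add0r, mulN1r) maxxx.
rewrite !(max0n, max_r z0, max_r a0) /hit.
by congr [:: _; _; _; Num.max 0 _; _]; rewrite addrC opprD [- z + _]addrC.
Qed.

(** A gate: it passes the label on a full hit and gives 0 on a miss, as long as the label is at most
    Q. *)
Definition label_term (Q : nat) z (e : nat * nat) : R :=
  Num.max 0 (e.2%:R + Q%:R * hit z e.1 - Q%:R).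

Definition add_label (Q : nat) : seq (seq (seq R * R)) :=
  [:: [:: ([:: 1], 0); ([:: 0; 1], 0); ([:: 0; 0; 1], 0);
          ([:: 0; 0; 0; Q%:R; 1], - Q%:R)];
      [:: ([:: 1], 0); ([:: 0; 1], 0); ([:: 0; 0; 1; 1], 0);
          ([::], 0); ([::], 0)]].

Lemma run_add_label Q z (u : nat) a (e : nat * nat) : 0 <= z -> 0 <= a ->
  run (add_label Q) [:: z; u%:R; a; hit z e.1; e.2%:R] =
  [:: z; u%:R; a + label_term Q z e; 0; 0].
Proof.
move=> z0 a0; rewrite /run /layer_eval /=.
rewrite !(mul1r, mul0r, addr0, add0r) !maxxx.
rewrite [Q%:R * _ + _]addrC -/(label_term Q z e) !(max0n, max_r z0, max_r a0).
by rewrite max_r // addr_ge0 // le_max lexx.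
Qed.

(** Each entry takes 2b bits, key above label, with the first entry on top; the first argument of
    [extract_digit] is the number of bits still below the digit. *)
Fixpoint decode (b n : nat) : seq (seq (seq R * R)) :=
  if n is n'.+1 then
    extract_digit (2 * b * n' + b) b ++ test_key ++
    extract_digit (2 * b * n') b ++ add_label (2 ^ b) ++ decode b n'
  else [::].

(* Groups shorter than [n] are padded with the label 0, which adds nothing to
   the output (label_term_label0). *)
Fixpoint encode (b n : nat) s : nat :=
  if n is n'.+1 then
    ((head (0, 0)%N s).1 * 2 ^ (2 * b * n' + b) + (head (0, 0)%N s).2 *
      2 ^ (2 * b * n') + encode b n' (behead s))%N
  else 0%N.

Definition fits b s := all (fun e => (e.1 < 2 ^ b) && (e.2 < 2 ^ b))%N s.

Lemma encode_lt b n s : fits b s -> (encode b n s < 2 ^ (2 * b * n))%N.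
Proof.
elim: n s => [|n IH] s hs /=; first by rewrite muln0.
have hb : fits b (behead s) by case: s hs => //= e s /andP[].
have /andP[h1 h2] : ((head (0, 0)%N s).1 < 2 ^ b)%N && ((head (0, 0)%N s).2 < 2 ^ b)%N.
  by case: s hs {hb} => [|e s] /=; [rewrite expn_gt0 | case/andP].
have := IH _ hb; set E := encode _ _ _ => hE.
have -> : (2 * b * n.+1 = b + (2 * b * n + b))%N by lia.
rewrite !expnD; move: h1 h2 hE; move: (2 ^ b)%N (2 ^ (2 * b * n))%N => Q P.
move: (head _ s) E => [k y] /= E h1 h2 hE.
(* A digit plus one is at most Q, which leaves room for everything below that digit. *)
have h3 : (y.+1 * P <= Q * P)%N by rewrite leq_mul2r h2 orbT.
have h4 : (k.+1 * (P * Q) <= Q * (P * Q))%N by rewrite leq_mul2r h1 orbT.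
lia.
Qed.

(** Each round leaves the encoding of the tail and zeros in the flag and digit registers, which is
    the starting state of the next round. *)
Lemma run_decode b n s z a : fits b s -> 0 <= z -> 0 <= a ->
  run (decode b n) [:: z; (encode b n s)%:R; a; 0; 0] =
  [:: z; 0; a + \sum_(j < n) label_term (2 ^ b) z (nth (0, 0)%N s j); 0; 0].
Proof.
move=> + z0; elim: n s a => [|n IH] s a hs a0.
  by rewrite big_ord0 addr0.
have hb : fits b (behead s) by case: s hs => //= e s /andP[].
have hE := encode_lt n hb.
have he : ((head (0, 0) s).1 < 2 ^ b)%N && ((head (0, 0) s).2 < 2 ^ b)%N.
  by case: s hs {hb hE} => [|e s] /=; [rewrite expn_gt0 | case/andP].
case/andP: he => hk hy.
have -> : decode b n.+1 = extract_digit (2 * b * n + b) b ++ test_key ++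
  extract_digit (2 * b * n) b ++ add_label (2 ^ b) ++ decode b n by [].
rewrite 4!run_cat [encode b n.+1 s]/= -addnA run_extract_leading_digit //.
  rewrite run_test_key // run_extract_leading_digit // ?le_max ?lexx //.
  rewrite run_add_label // IH ?addr_ge0 ?le_max ?lexx // big_ord_recl addrA.
  congr [:: _; _; _ + _ + _; _; _].
  by apply: eq_bigr => j _; case: s {hs hb hE hk hy} => //=; rewrite nth_nil.
rewrite expnD [X in (_ < X)%N]mulnC.
move: (2 ^ b)%N (2 ^ (2 * b * n))%N hy hE => Q P hy hE.
by apply: (@leq_trans ((head (0, 0) s).2.+1 * P)%N);
  [lia | rewrite leq_mul2r hy orbT].
Qed.

Lemma hit_in z k : k%:R <= z <= k%:R + 1 -> hit z k = 1.
Proof.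
case/andP => h1 h2; rewrite /hit [Num.max 0 (k%:R - z)]max_l; last lra.
by rewrite [Num.max 0 (z - k%:R - 1)]max_l ?max_r; lra.
Qed.

(** Separation 2 is made for this: a z at distance at least 2 from a point with integer part k lies
    in this range. *)
Lemma hit_out z k : z <= k%:R - 1 \/ k%:R + 2 <= z -> hit z k = 0.
Proof.
move=> h; apply: max_l; rewrite subr_le0; case: h => h.
  have h1 : k%:R - z <= Num.max 0 (k%:R - z) by rewrite le_max lexx orbT.
  have h2 : 0 <= Num.max 0 (z - k%:R - 1) by rewrite le_max lexx.
  lra.
have h1 : z - k%:R - 1 <= Num.max 0 (z - k%:R - 1) by rewrite le_max lexx orbT.
have h2 : 0 <= Num.max 0 (k%:R - z) by rewrite le_max lexx.
lra.
Qed.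

Lemma label_term_hit Q z e : hit z e.1 = 1 -> label_term Q z e = e.2%:R.
Proof. by move=> h; rewrite /label_term h mulr1 addrK max0n. Qed.

Lemma label_term_miss Q z e : hit z e.1 = 0 -> (e.2 <= Q)%N ->
  label_term Q z e = 0.
Proof.
move=> h hQ; rewrite /label_term h mulr0 addr0 max_l // subr_le0 ler_nat //.
Qed.

(** A hit is at most 1, so the argument of the ReLU is never positive, whatever the key. *)
Lemma label_term_label0 Q z k : label_term Q z (k, 0%N) = 0.
Proof.
rewrite /label_term /=; apply: max_l; rewrite add0r subr_le0.
rewrite ler_piMr // ge_max ler01 gerBl addr_ge0 // le_max lexx //.
Qed.

(** A jump of height D at the threshold k; with D the difference of consecutive encodings, the jumps
    telescope. *)
Definition select_step (k : nat) (D : R) : seq (seq (seq R * R)) :=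
  [:: [:: ([:: 1], 0); ([:: 0; 1], 0); ([:: 1], 1 - k%:R); ([:: 1], - k%:R)];
      [:: ([:: 1], 0); ([:: 0; 1; D; - D], 0)]].

Lemma run_select_step k z (U V W : nat) : 0 <= z ->
  z <= k%:R - 1 \/ k%:R <= z -> (k%:R <= z -> W = U) ->
  run (select_step k (V%:R - U%:R)) [:: z; W%:R] =
  [:: z; (if k%:R <= z then V else W)%:R].
Proof.
move=> z0 /ramp_sub h hW; rewrite /run /layer_eval /=.
rewrite !(mul1r, mul0r, addr0, add0r) !(max0n, max_r z0).
rewrite mulNr -mulrBr h; congr [:: _; _]; case: ifP hW => [_ ->|_ _] //=.
  by rewrite mulr1 subrKC max0n.
by rewrite mulr0 addr0 max0n.
Qed.

(** * Memorizing a sorted list of keys and labels *)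

Section Dataset.
Variables (b n : nat) (s : seq (nat * nat)).
Hypothesis n_gt0 : (0 < n)%N.
Hypothesis s_fits : fits b s.

Lemma fits_drop k : fits b (drop k s).
Proof. by move: s_fits; rewrite /fits -{1}(cat_take_drop k s) all_cat => /andP[]. Qed.

Let group j := encode b n (drop (j * n) s).
(* The default key [2 ^ b] exceeds all points, so no group past the end of [s]
   is ever selected. *)
Let key j := (nth (2 ^ b, 0)%N s j).1.

Fixpoint select (m : nat) : seq (seq (seq R * R)) :=
  if m is m'.+1 then
    select m' ++ select_step (key (m'.+1 * n)) ((group m'.+1)%:R - (group m')%:R)
  else [::].

Definition memorize (m : nat) : seq (seq (seq R * R)) :=
  [:: ([:: 1], 0); ([::], (group 0)%:R)] :: select m ++
  [:: ([:: 1], 0); ([:: 0; 1], 0); ([::], 0); ([::], 0); ([::], 0)] ::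
  decode b n.

(** The jump to group j sits at the key in position jn, which z has reached exactly when jn <= i;
    the chain thus stops at the group containing position i. *)
Lemma run_select m i z : 0 <= z -> z <= (2 ^ b)%:R - 1 ->
  (i < size s)%N -> (forall j, (j <= i)%N -> (key j)%:R <= z) ->
  (forall j, (i < j < size s)%N -> z <= (key j)%:R - 1) ->
  run (select m) [:: z; (group 0)%:R] = [:: z; (group (minn m (i %/ n)))%:R].
Proof.
move=> z0 zb hi hle hgt; elim: m => [|m IH]; first by rewrite min0n.
have hkey : (key (m.+1 * n))%:R <= z <-> (m < i %/ n)%N.
  rewrite leq_divRL //; split=> [h|]; last exact: hle.
  rewrite leqNgt; apply/negP => him.
  have : z <= (key (m.+1 * n))%:R - 1.
    have [hs|hs] := ltnP (m.+1 * n) (size s); first by apply: hgt; rewrite him.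
    by rewrite /key nth_default.
  lra.
rewrite [select _]/= run_cat IH run_select_step //.
- congr [:: _; _%:R]; case: ifP => [/hkey h|/negP h].
    by congr group; lia.
  have {}h : (i %/ n <= m)%N by rewrite leqNgt; apply/negP => /hkey.
  by congr group; lia.
- have [h|h] := ltnP m (i %/ n); first by right; apply/hkey.
  left; have him : (i < m.+1 * n)%N by rewrite -ltn_divLR.
  have [hs|hs] := ltnP (m.+1 * n) (size s); first by apply: hgt; rewrite him.
  by rewrite /key nth_default.
- by move/hkey => h; congr group; lia.
Qed.

Lemma run_memorize m i z : z <= (2 ^ b)%:R - 1 -> (i < size s)%N ->
  (i < m * n)%N -> (key i)%:R <= z <= (key i)%:R + 1 ->
  (forall j, (j < i)%N -> (key j)%:R + 2 <= z) ->
  (forall j, (i < j < size s)%N -> z <= (key j)%:R - 1) ->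
  (run (memorize m) [:: z])`_2 = (nth (0, 0)%N s i).2%:R.
Proof.
move=> zb hi him hz hlt hgt.
have z0 : 0 <= z by case/andP: hz => + _; apply: le_trans.
have {}him : minn m (i %/ n) = (i %/ n)%N.
  by apply/minn_idPr; rewrite ltnW // ltn_divLR.
have hle j : (j <= i)%N -> (key j)%:R <= z.
  rewrite leq_eqVlt => /predU1P[->|/hlt]; first by case/andP: hz.
  by apply: le_trans; rewrite lerDl.
have nth_key j : (j < size s)%N -> key j = (nth (0, 0)%N s j).1.
  by move=> hj; rewrite /key (set_nth_default (0, 0)%N).
rewrite /memorize -cat1s run_cat run_cat -[_ :: decode b n]cat1s run_cat.
have -> : run [:: [:: ([:: 1], 0); ([::], (group 0)%:R)]] [:: z] =
    [:: z; (group 0)%:R].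
  by rewrite /run /layer_eval /= mul1r !addr0 add0r max0n max_r.
rewrite (@run_select m i) // him.
set L := [:: [:: _; _; _; _; _]].
have -> k : run L [:: z; k%:R] = [:: z; k%:R; 0; 0; 0].
  by rewrite /run /layer_eval /= !(mul1r, mul0r, addr0, add0r) max0n max_r // maxxx.
rewrite run_decode ?fits_drop //= add0r (bigD1 (Ordinal (ltn_pmod i n_gt0))) //= big1.
  rewrite addr0 nth_drop -divn_eq label_term_hit // -nth_key // hit_in //.
move=> j; rewrite -val_eqE /= nth_drop => hj.
have {}hj : (i %/ n * n + j != i)%N.
  by apply: contra hj => /eqP <-; rewrite modnMDl modn_small.
(* The position in [s] of another entry of the selected group; past the end of [s] it is padding. *)
set k := (_ + _)%N in hj *.
have [hk|hk] := leqP (size s) k; first by rewrite nth_default // label_term_label0.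
apply: label_term_miss; last first.
  by apply/ltnW; have /allP/(_ _ (mem_nth (0, 0)%N hk))/andP[] := s_fits.
rewrite -nth_key // hit_out //.
by case: (ltngtP k i) hj => // hki _; [right; exact: hlt | left; rewrite hgt ?hki].
Qed.

(** Every jump, extracted bit, key test and label addition takes two layers, and each of the n
    entries has 2b bits. *)
Lemma size_memorize m :
  size (memorize m) = (2 + 2 * m + n * (4 * b + 4))%N.
Proof.
have hd T b' : size (extract_digit T b') = (2 * b')%N.
  by elim: b' => //= b' ->; lia.
have hs : size (select m) = (2 * m)%N.
  by elim: m => //= m IH; rewrite size_cat IH /=; lia.
have hn : size (decode b n) = (n * (4 * b + 4))%N.
  elim: n => // k IH.
  have -> : decode b k.+1 = extract_digit (2 * b * k + b) b ++ test_key ++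
    extract_digit (2 * b * k) b ++ add_label (2 ^ b) ++ decode b k by [].
  by rewrite !size_cat !hd IH /=; lia.
by rewrite /= size_cat hs /= hn; lia.
Qed.

Lemma bounded_decode B k : (0 < B)%N -> (2 * b * k <= B)%N ->
  all (bounded_layer B) (decode b k).
Proof.
move=> B0 hB.
have h1 : (1 <= 2 ^ B)%N by rewrite expn_gt0.
(* The weight 2 shifts the assembled digit; this is where [0 < B] enters. *)
have h2 : (2 <= 2 ^ B)%N by rewrite -[leqLHS](expn1 2) leq_exp2l.
have bits P : (P <= 2 ^ B)%N -> all (bounded_layer B) (extract_bit P).
  move=> hP; rewrite /= /bounded_layer /= !bounded_int0 !bounded_int1.
  rewrite !bounded_intN1 bounded_int_opp // bounded_int_nat //.
  by rewrite (@bounded_int_sub _ _ 1) // (@bounded_int_nat _ _ 2).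
have digit T b' : (T + b' <= B)%N -> all (bounded_layer B) (extract_digit T b').
  elim: b' => // b' IH hb'; have -> : extract_digit T b'.+1 =
      extract_bit (2 ^ (T + b')) ++ extract_digit T b' by [].
  by rewrite all_cat bits ?IH ?leq_exp2l //; lia.
elim: k hB => // k IH hB.
have -> : decode b k.+1 = extract_digit (2 * b * k + b) b ++ test_key ++
  extract_digit (2 * b * k) b ++ add_label (2 ^ b) ++ decode b k by [].
rewrite !all_cat !digit ?IH; try lia.
have hQ : (2 ^ b <= 2 ^ B)%N by rewrite leq_exp2l //; lia.
rewrite /= /bounded_layer /= !bounded_int0 !bounded_int1 !bounded_intN1.
by rewrite bounded_int_opp // bounded_int_nat.
Qed.

(** The group encodings, below 2^(2bn), dominate; a jump height is a difference of two of them and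
    obeys the same bound. *)
Lemma bounded_memorize m : (0 < b)%N ->
  all (bounded_layer (2 * b * n)) (memorize m).
Proof.
move=> b0; have B0 : (0 < 2 * b * n)%N by rewrite !muln_gt0 b0 n_gt0.
set B := (2 * b * n)%N in B0 *.
have hg j : (group j <= 2 ^ B)%N.
  by apply/ltnW/encode_lt/fits_drop.
have hk j : (key j <= 2 ^ B)%N.
  apply: (@leq_trans (2 ^ b)); last first.
    by rewrite leq_exp2l // /B mulnAC leq_pmull // muln_gt0.
  have [js|js] := leqP (size s) j; first by rewrite /key nth_default.
  by apply/ltnW; have /allP/(_ _ (mem_nth (2 ^ b, 0)%N js))/andP[] := s_fits.
have hs : all (bounded_layer B) (select m).
  elim: m => // m IH; rewrite [select _]/= all_cat IH /=.
  rewrite /bounded_layer /= !bounded_int0 !bounded_int1 bounded_int_opp //.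
  rewrite (@bounded_int_sub _ _ 1) ?expn_gt0 // opprB.
  by rewrite !bounded_int_sub.
rewrite /memorize /= all_cat hs /= bounded_decode //.
by rewrite /bounded_layer /= !bounded_int0 !bounded_int1 bounded_int_nat.
Qed.

End Dataset.
End Programs.

(** * Separating the samples on a line *)

Section Projection.
Variable R : realType.

(* Once the other coordinates of [u] are fixed, [u k] is determined, because
   changing it moves the inner product by at least [2 * c]. *)
Lemma card_small_inner d Q (v : 'I_d -> R) (c : R) k : 2 * c <= `|v k| ->
  (#|[set u : {ffun 'I_d -> 'I_Q} | `|\sum_l (u l)%:R * v l|%R < c]%R| * Q
    <= #|{ffun 'I_d -> 'I_Q}|)%N.
Proof.
move=> hk; set A := [set u | _].
(* Overwriting coordinate k by a free value is injective on A times the Q values, which gives the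
   count. *)
pose f (w : {ffun 'I_d -> 'I_Q} * 'I_Q) : {ffun 'I_d -> 'I_Q} :=
  [ffun l => if l == k then w.2 else w.1 l].
have fI : {in finset.setX A finset.setT &, injective f}.
  move=> [u q] [u' q'] /finset.setXP[/= hu _] /finset.setXP[/= hu' _] /ffunP e.
  have eq : q = q' by have := e k; rewrite !ffunE eqxx.
  have eo l : l != k -> u l = u' l.
    by move=> /negbTE lk; have := e l; rewrite !ffunE lk.
  suff ek : u k = u' k.
    rewrite eq; congr pair; apply/ffunP => l.
    by have [->|/eo] := eqVneq l k.
  move: hu hu'; rewrite !inE => hu hu'.
  have hd : \sum_l (u l)%:R * v l - \sum_l (u' l)%:R * v l =
      ((u k)%:R - (u' k)%:R) * v k.
    rewrite -sumrB (bigD1 k) //= big1 ?addr0 ?mulrBl // => l /eo ->.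
    by rewrite subrr.
  have hlt : `|((u k)%:R - (u' k)%:R) * v k| < 2 * c.
    by rewrite -hd (le_lt_trans (ler_normB _ _)) //; lra.
  have hone : `|(u k)%:R - (u' k)%:R| < 1 :> R.
    rewrite ltNge; apply/negP => h; move: hlt; rewrite normrM ltNge => /negP; apply.
    by rewrite (le_trans hk) // ler_peMl.
  apply/val_inj/eqP => /=; rewrite eqn_leq -(ltnS (u k)) -(ltnS (u' k)).
  rewrite -!(ltr_nat R) -!natr1.
  by move: hone; rewrite ltr_norml => /andP[h1 h2]; apply/andP; split; lra.
have := card_in_imset fI; rewrite finset.cardsX cardsT card_ord => <-.
exact: max_card.
Qed.

(** Union bound: each p rules out at most a fraction 1/Q of the vectors, and there are fewer than Q
    indices p. *)
Lemma separating_vector d Q (I : finType) (P : pred I)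
    (v : I -> 'I_d -> R) (c : R) :
  (#|I| < Q)%N -> (forall p, P p -> exists k, 2 * c <= `|v p k|) ->
  exists u : 'I_d -> 'I_Q,
    forall p, P p -> c <= `|\sum_l (u l)%:R * v p l|.
Proof.
move=> hQ hP.
pose bad p := [set u : {ffun 'I_d -> 'I_Q} |
  P p && (`|\sum_l (u l)%:R * v p l| < c)].
have hbad p : (#|bad p| * Q <= #|{ffun 'I_d -> 'I_Q}|)%N.
  have [Pp|nPp] := boolP (P p); last first.
    by rewrite (_ : bad p = finset.set0) ?cards0 //;
      apply/finset.setP => u; rewrite !inE (negbTE nPp).
  have [k hk] := hP p Pp.
  by rewrite /bad Pp /=; exact: (@card_small_inner d Q (v p) c k hk).
have [/existsP[u /forallP hu]|hno] :=
  boolP [exists u, [forall p, u \notin bad p]].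
  exists u => p Pp; have := hu p; rewrite inE Pp /= -leNgt //.
exfalso.
(* Every vector being bad for some p, the bad sets cover all vectors. *)
have h1 : (#|{ffun 'I_d -> 'I_Q}| <= \sum_p #|bad p|)%N.
  have -> : (\sum_p #|bad p| = \sum_u \sum_p (u \in bad p))%N.
    rewrite exchange_big /=; apply: eq_bigr => p _.
    by rewrite -sum1_card big_mkcond.
  rewrite -sum1_card; apply: leq_sum => u _.
  have : ~~ [forall p, u \notin bad p] by move: hno; rewrite negb_exists => /forallP.
  rewrite negb_forall => /existsP[p]; rewrite negbK => up.
  by rewrite (bigD1 p) //= up.
have h2 : (\sum_p #|bad p| * Q <= #|I| * #|{ffun 'I_d -> 'I_Q}|)%N.
  rewrite -sum_nat_const; exact: leq_sum.
have h3 : (0 < #|{ffun 'I_d -> 'I_Q}|)%N.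
  by rewrite card_ffun !card_ord expn_gt0 (leq_ltn_trans _ hQ).
have h4 : (#|{ffun 'I_d -> 'I_Q}| * Q <= #|I| * #|{ffun 'I_d -> 'I_Q}|)%N.
  by apply: leq_trans h2; rewrite -big_distrl leq_mul2r h1 orbT.
move: h4; rewrite mulnC leq_mul2r; lia.
Qed.

(** Sort by z and take integer parts as keys: separation 2 puts earlier keys at least 2 below [z i]
    and later keys at least 1 above it. *)
Lemma memorize_separated N b n m (z : 'I_N -> R) (y : 'I_N -> nat) :
  (0 < n)%N -> (N <= m * n)%N -> (forall i, 0 <= z i <= (2 ^ b)%:R - 1) ->
  (forall i, (y i < 2 ^ b)%N) -> (forall i j, i != j -> 2 <= `|z i - z j|) ->
  exists2 s, fits b s &
    forall i, (run (memorize R b n s m) [:: z i])`_2 = (y i)%:R.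
Proof.
move=> n0 hN hz hy hsep.
pose le i j := z i <= z j.
pose o := sort le (enum 'I_N).
have so : size o = N by rewrite size_sort size_enum_ord.
have oo : sorted le o by apply: sort_sorted => i j; exact: le_total.
have uo : uniq o by rewrite sort_uniq enum_uniq.
pose F i := (Num.truncn (z i), y i).
have hzn i : 0 <= z i by case/andP: (hz i).
have hF i : (Num.truncn (z i))%:R <= z i < (Num.truncn (z i)).+1%:R by exact: truncn_itv.
have Fo : fits b (map F o).
  rewrite /fits all_map; apply/allP => i _ /=; rewrite hy andbT -(ltr_nat R).
  by have /andP[? _] := hF i; have /andP[? ?] := hz i; lra.
exists (map F o) => // i.
have io : i \in o by rewrite mem_sort mem_enum.
pose k := index i o.
have hk : (k < size o)%N by rewrite index_mem.
have ik : nth i o k = i by exact: nth_index.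
have gap j l : (j < l < size o)%N -> z (nth i o j) + 2 <= z (nth i o l).
  case/andP=> jl lo; have jo := ltn_trans jl lo.
  have : z (nth i o j) <= z (nth i o l).
    apply: (@sorted_ltn_nth _ le) => // ? ? ?; exact: le_trans.
  have /hsep : nth i o j != nth i o l by rewrite nth_uniq // ltn_eqF.
  by rewrite distrC => h1 h2; move: h1; rewrite ger0_norm ?subr_ge0 //; lra.
have nk j : (j < size o)%N -> nth (2 ^ b, 0)%N (map F o) j = F (nth i o j).
  by move=> jo; rewrite (nth_map i).
have := hF i; rewrite -natr1 => /andP[hFi1 hFi2].
rewrite (@run_memorize _ b n _ n0 Fo m k) ?size_map //.
- by rewrite (nth_map i) // ik.
- by case/andP: (hz i).
- by apply: leq_trans hN; rewrite -so.
- by rewrite nk // ik /=; apply/andP; split; [|exact: ltW].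
- move=> j jk; have jo := ltn_trans jk hk; rewrite nk //=.
  have /andP[h _] := hF (nth i o j).
  by have := @gap j k; rewrite jk hk ik => /(_ isT); lra.
- move=> j /andP[kj jo]; rewrite nk //=.
  have := hF (nth i o j); rewrite -natr1 => /andP[_ h].
  by have := @gap k j; rewrite kj jo ik => /(_ isT); lra.
Qed.

End Projection.

(** * Norms, logarithms and the network for given parameters *)

Section Estimates.
Variable R : realType.

Lemma entry_le_enorm d (v : 'cV[R]_d) k : `|v k 0| <= enorm v.
Proof.
rewrite -sqrtr_sqr ler_wsqrtr // (bigD1 k) //= lerDl.
by apply: sumr_ge0 => i _; exact: sqr_ge0.
Qed.

(** The crude factor d, in place of its square root, avoids radicals; the fourth power of [Rq]
    absorbs it in the end. *)
Lemma enorm_le_entry d (v : 'cV[R]_d) : (0 < d)%N ->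
  exists k, enorm v <= d%:R * `|v k 0|.
Proof.
case: d v => // d v _.
pose k := [arg max_(l > ord0) `|v l 0|]%O; exists k.
have hk l : `|v l 0| <= `|v k 0|.
  by rewrite /k; case: arg_maxP => // i _ h; exact: h.
have c0 : 0 <= d.+1%:R * `|v k 0| by rewrite mulr_ge0.
rewrite -[leRHS]ger0_norm // -sqrtr_sqr ler_wsqrtr //.
apply: (@le_trans _ _ (\sum_(i < d.+1) `|v k 0| ^+ 2)).
  by apply: ler_sum => i _; rewrite -real_normK ?num_real // lerXn2r ?nnegrE.
rewrite sumr_const card_ord -[leLHS]mulr_natl exprMn ler_wpM2r ?sqr_ge0 //.
by rewrite -natrX ler_nat -mulnn mulnS leq_addr.
Qed.

Lemma exp_lt_pow2 (t : R) b j : 0 < t -> j%:R * log2 t < b%:R ->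
  t ^+ j < (2 ^ b)%:R.
Proof.
move=> t0; rewrite /log2 mulrA ltr_pdivrMr ?ln_gt0 ?ltr1n // => h.
rewrite -ltr_ln ?posrE ?exprn_gt0 // ?ltr0n ?expn_gt0 //.
by rewrite natrX !lnXn // -[_ *+ j]mulr_natl -[_ *+ b]mulr_natl.
Qed.

(** Projections of size at most 5T, shifted by a [beta] between 5T and 6T, lie in [0, 11T]; as T >=
    1, the bound 12T <= 2^b puts them below 2^b - 1. *)
Lemma projection_net N d (x : 'I_N -> 'cV[R]_d) (y : 'I_N -> nat)
    (r delta : R) b n m :
  (0 < N)%N -> (0 < d)%N -> (0 < n)%N -> (0 < b)%N -> (N <= m * n)%N ->
  1 <= r -> 0 < delta <= 1 ->
  (forall i, enorm (x i) <= r) ->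
  (forall i j, i != j -> delta <= enorm (x i - x j)) ->
  (forall i, (y i < 2 ^ b)%N) ->
  12 * (d%:R ^+ 2 * N%:R ^+ 2 * r / delta) <= (2 ^ b)%:R ->
  exists F : relu_net R d, [/\ net_width F = 12%N,
    net_depth F = (4 + 2 * m + n * (4 * b + 4))%N,
    forall w, w \in net_weights F -> bounded_int (2 * b * n) w
    & forall i, net_eval F (x i) = (y i)%:R].
Proof.
move=> N0 d0 n0 b0 hN r1 /andP[de0 de1] hx hsep hy.
set T := d%:R ^+ 2 * N%:R ^+ 2 * r / delta => hT.
have dR : 1 <= d%:R :> R by rewrite ler1n.
have NR : 1 <= N%:R ^+ 2 :> R by rewrite exprn_ege1 // ler1n.
(* The entries of u range over 0, ..., N^2, one value more than there are ordered pairs. *)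
have hQ : (#|{: 'I_N * 'I_N}| < (N ^ 2).+1)%N by rewrite card_prod card_ord mulnn.
have [|u hu] := @separating_vector R d _ _ [pred p : 'I_N * 'I_N | p.1 != p.2]
    (fun p l => x p.1 l 0 - x p.2 l 0) (delta / (2 * d%:R)) hQ.
  move=> [i j] /= ij; have [k hk] := enorm_le_entry (x i - x j) d0.
  exists k; have -> : 2 * (delta / (2 * d%:R)) = delta / d%:R by field; lra.
  rewrite ler_pdivrMr ?(lt_le_trans ltr01) // mulrC.
  by move: hk; rewrite !mxE; apply: le_trans; exact: hsep.
(* The vector u separates by delta/(2d); a factor above 4d/delta raises this to 2. *)
set S := (Num.truncn (4 * d%:R / delta)).+1.
have dde : 1 <= d%:R / delta by rewrite ler_pdivlMr // mul1r (le_trans de1).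
have hS1 : 4 * d%:R / delta < S%:R by exact: truncnS_gt.
have hS2 : S%:R <= 5 * (d%:R / delta).
  rewrite /S -natr1.
  have : (Num.truncn (4 * d%:R / delta))%:R <= 4 * d%:R / delta.
    by rewrite truncn_le -mulrA mulr_ge0 // (le_trans ler01).
  rewrite -mulrA; lra.
pose v l : R := (S * u l)%:R.
set beta := (Num.truncn (5 * T)).+1.
have T1 : 1 <= T.
  have -> : T = d%:R * (N%:R ^+ 2) * r * (d%:R / delta) by rewrite /T; field; lra.
  by do 3?[apply: mulr_ege1 => //].
have hb1 : 5 * T < beta%:R by exact: truncnS_gt.
have hb2 : beta%:R <= 6 * T.
  rewrite /beta -natr1; have : (Num.truncn (5 * T))%:R <= 5 * T.
    by rewrite truncn_le; lra.
  lra.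
have hul l : (u l)%:R <= N%:R ^+ 2 :> R.
  by rewrite -natrX ler_nat -ltnS; exact: ltn_ord.
have hvS l : v l <= 5 * (d%:R / delta) * N%:R ^+ 2.
  by rewrite /v natrM ler_pM.
have hv i : `|\sum_l v l * x i l 0| <= 5 * T.
  apply: (le_trans (ler_norm_sum _ _ _)).
  apply: (@le_trans _ _ (\sum_(l < d) 5 * (d%:R / delta) * N%:R ^+ 2 * r)).
    apply: ler_sum => l _; rewrite normrM ler_pM //.
      by rewrite ger0_norm /v ?ler0n //; exact: hvS.
    exact: le_trans (entry_le_enorm _ _) (hx i).
  rewrite sumr_const card_ord -[_ *+ d]mulr_natl le_eqVlt; apply/orP; left.
  by apply/eqP; rewrite /T; field; lra.
have [||s hs hrun] := @memorize_separated R N b n m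
    (fun i => \sum_l v l * x i l 0 + beta%:R) y n0 hN _ hy.
- move=> i; have := hv i; rewrite ler_norml => /andP[h1 h2].
  by apply/andP; split; lra.
- move=> i j ij; have := hu (i, j) ij => /= huij.
  have -> : \sum_l v l * x i l 0 + beta%:R - (\sum_l v l * x j l 0 + beta%:R)
      = S%:R * \sum_l (u l)%:R * (x i l 0 - x j l 0).
    rewrite opprD addrACA subrr addr0 -sumrB mulr_sumr; apply: eq_bigr => l _.
    by rewrite /v natrM -mulrBr mulrA.
  rewrite normrM ger0_norm ?ler0n //.
  apply: (@le_trans _ _ (4 * d%:R / delta * (delta / (2 * d%:R)))).
    by rewrite le_eqVlt; apply/orP; left; apply/eqP; field; lra.
  by apply: ler_pM; rewrite // ?ltW // divr_gt0 //; lra.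
have B0 : (b <= 2 * b * n)%N by rewrite mulnAC leq_pmull // muln_gt0.
have bB : (2 ^ b <= 2 ^ (2 * b * n))%N by rewrite leq_exp2l.
have hp := bounded_memorize R n0 hs m b0.
exists (input_net v beta%:R (memorize R b n s m)); split.
- exact: input_net_width.
- by rewrite input_net_depth size_memorize.
- apply: input_net_weights => // [l|]; apply: bounded_int_nat.
    apply: leq_trans bB; rewrite -(ler_nat R); apply: le_trans hT.
    apply: (le_trans (hvS l)).
    have -> : T = d%:R / delta * N%:R ^+ 2 * (d%:R * r) by rewrite /T; field; lra.
    set g := d%:R / delta * N%:R ^+ 2.
    have g0 : 0 <= g by rewrite mulr_ge0 ?(le_trans ler01).
    have : g <= g * (d%:R * r) by rewrite ler_peMr // mulr_ege1.
    by rewrite -mulrA -/g; lra.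
  apply: leq_trans bB; rewrite -(ler_nat R); lra.
- move=> i; rewrite (input_net_eval hp) ?hrun //.
  by have := hv i; rewrite ler_norml => /andP[h1 h2]; lra.
Qed.

Lemma le_log2 (a c : R) : 0 < a -> a <= c -> log2 a <= log2 c.
Proof.
move=> a0 ac; rewrite /log2 ler_pM2r ?invr_gt0 ?ln_gt0 ?ltr1n //.
by rewrite ler_ln // posrE (lt_le_trans a0).
Qed.

Lemma log2_2 : log2 2 = 1 :> R.
Proof. by rewrite /log2 divff // gt_eqF // ln_gt0 // ltr1n. Qed.

Lemma log2_le_nat (n : nat) : log2 n%:R <= n%:R :> R.
Proof.
case: n => [|n]; first by rewrite /log2 ln0 // mul0r.
rewrite /log2 ler_pdivrMr ?ln_gt0 ?ltr1n // mulr_natl -lnXn //.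
rewrite ler_ln ?posrE ?ltr0n ?exprn_gt0 // -natrX ler_nat.
by rewrite ltnW // ltn_expl.
Qed.

(** Rounding up adds at most 1, hence at most doubles a number that is at least 1. *)
Lemma nat_above (a : R) : 1 <= a -> exists2 k : nat, a < k%:R & k%:R <= 2 * a.
Proof.
move=> a1; exists (Num.truncn a).+1; first exact: truncnS_gt.
rewrite -natr1; have : (Num.truncn a)%:R <= a.
  by rewrite truncn_le (le_trans ler01).
lra.
Qed.

End Estimates.

(** * Choice of the digit length, the group size and the number of groups *)

Theorem theoremA1 (R : realType) :
  exists2 K : R, 0 < K &
  forall (N d C : nat) (r delta : R) (x : 'I_N -> 'cV[R]_d) (y : 'I_N -> nat),
  (2 <= N)%N -> 1 <= r -> 0 < delta <= 1 ->
  (forall i, (1 <= y i <= C)%N) ->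
  (forall i, enorm (x i) <= r) ->
  (forall i j, i != j -> delta <= enorm (x i - x j)) ->
  let Rq : R := 10 * r * N%:R ^+ 2 * delta^-1 * Num.sqrt (pi * d%:R) in
  let logN : R := log2 N%:R in
  let M : R := Num.sqrt (N%:R / logN) * Num.max (log2 Rq) (log2 C%:R) in
  exists F : relu_net R d,
    [/\ net_width F = 12%N,
        (net_depth F)%:R <= K * (Num.sqrt (N%:R * logN) + M),
        finite_bit_complexity F,
        (bit_complexity F)%:R <= K * (log2 d%:R + M)
      & forall i, net_eval F (x i) = (y i)%:R].
Proof.
(* The decoding depth n(4b + 4) dominates: n is at most twice the root of N/L, and 4b + 4 <= 36X
   because b <= 8X and X >= 1. *)
exists 72; first by rewrite ltr0n.
move=> N d C r delta x y N2 r1 hde hy hx hsep Rq L M.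
have [de0 de1] := andP hde.
(* In dimension 0 two samples would coincide, against the separation. *)
have d0 : (0 < d)%N.
  case: d x hx hsep {Rq M} => // x _ hsep.
  have /hsep : Ordinal (ltnW N2) != Ordinal N2 by [].
  by rewrite /enorm big_ord0 sqrtr0 leNgt de0.
have dR : 1 <= d%:R :> R by rewrite ler1n.
have NR : 2 <= N%:R :> R by rewrite ler_nat.
have C0 : (0 < C)%N by have /andP[h1 h2] := hy (Ordinal N2); exact: leq_trans h2.
have L1 : 1 <= L by rewrite -[leLHS](log2_2 R) le_log2 // ltr0n.
have LN : L <= N%:R by exact: log2_le_nat.
have L0 : 0 < L by lra.
have pi1 : 1 <= pi :> R by rewrite (le_trans _ (pi_ge2 R)) // ler1n.
have dei : 1 <= delta^-1 by rewrite invf_ge1.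
have N21 : 1 <= N%:R ^+ 2 :> R by rewrite exprn_ege1 //; lra.
have s1 : 1 <= Num.sqrt (pi * d%:R) :> R.
  by rewrite -[leLHS](sqrtr1 R) ler_wsqrtr // mulr_ege1.
have Rq10 : 10 <= Rq.
  rewrite /Rq -!mulrA ler_peMr //.
  have N1 : 1 <= N%:R :> R by lra.
  by do 4?[apply: mulr_ege1 => //].
have Rq0 : 0 < Rq by lra.
set X := Num.max (log2 Rq) (log2 C%:R) in M *.
have XR : log2 Rq <= X by rewrite le_max lexx.
have XC : log2 C%:R <= X by rewrite le_max lexx orbT.
have X1 : 1 <= X.
  by apply: le_trans XR; rewrite -[leLHS](log2_2 R) le_log2 ?ltr0n //; lra.
(* The factor 4 yields Rq^4 < 2^b: [Rq] contains only the square root of d, while the projections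
   need d^2. *)
have [|b hb hbX] := @nat_above R (4 * X); first lra.
have hRb : Rq ^+ 4 < (2 ^ b)%:R by apply: exp_lt_pow2 => //; lra.
have hCb : (C < 2 ^ b)%N.
  rewrite -(ltr_nat R) -[C%:R]expr1; apply: exp_lt_pow2; first by rewrite ltr0n.
  by lra.
have A1 : 1 <= Num.sqrt (N%:R / L).
  by rewrite -[leLHS](sqrtr1 R) ler_wsqrtr // ler_pdivlMr // mul1r.
have B1 : 1 <= Num.sqrt (N%:R * L).
  by rewrite -[leLHS](sqrtr1 R) ler_wsqrtr // mulr_ege1 //; lra.
have [n hn1 hn] := nat_above A1; have [m hm1 hm] := nat_above B1.
have n0 : (0 < n)%N by rewrite -(ltr_nat R); lra.
have b0 : (0 < b)%N by rewrite -(ltr_nat R); lra.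
have hmn : (N <= m * n)%N.
  rewrite -(ler_nat R) natrM.
  have NL0 : 0 <= N%:R * L by rewrite mulr_ge0 // ltW.
  have -> : N%:R = Num.sqrt (N%:R * L) * Num.sqrt (N%:R / L) :> R.
    rewrite -(sqrtrM _ NL0).
    rewrite (_ : N%:R * L * (N%:R / L) = N%:R ^+ 2); last by field; lra.
    by rewrite sqrtr_sqr ger0_norm.
  by rewrite ler_pM // ltW.
have [|||F [hw hd hF hev]] := @projection_net R N d x y r delta b n m _ d0
    n0 b0 hmn r1 hde hx hsep.
- by rewrite (leq_trans _ N2).
- by move=> i; have /andP[_ h] := hy i; exact: leq_ltn_trans h hCb.
- apply: le_trans (ltW hRb).
  set g := r * N%:R ^+ 2 * delta^-1.
  have g1 : 1 <= g by do 2?[apply: mulr_ege1 => //].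
  have g0 : 0 <= g by lra.
  (* Now g <= g^4, d^2 <= (pi d)^2 and 12 <= 10^4 are compared factor by factor. *)
  have -> : Rq ^+ 4 = 100 * (100 * (g ^+ 4 * (pi * d%:R) ^+ 2)).
    have pd0 : 0 <= pi * d%:R :> R by rewrite mulr_ge0 // (le_trans ler01).
    rewrite -[X in _ * (100 * (_ * X ^+ 2))](sqr_sqrtr pd0).
    by rewrite /Rq /g; ring.
  have -> : d%:R ^+ 2 * N%:R ^+ 2 * r / delta = g * d%:R ^+ 2.
    by rewrite /g; ring.
  have hg : g <= g ^+ 4 by rewrite ler_eXnr.
  have hd : d%:R ^+ 2 <= (pi * d%:R) ^+ 2 :> R.
    by rewrite lerXn2r ?nnegrE ?mulr_ge0 // ?ler_peMl //; lra.
  have h1 : g * d%:R ^+ 2 <= g ^+ 4 * (pi * d%:R) ^+ 2.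
    by rewrite ler_pM // sqr_ge0.
  have h0 : 0 <= g * d%:R ^+ 2 by rewrite mulr_ge0 // sqr_ge0.
  lra.
have [hfin hbits] := bounded_weights_bits hF.
set a := Num.sqrt (N%:R / L) in hn hn1 A1 M *.
have aX0 : 0 <= a * X by rewrite mulr_ge0; lra.
exists F; split => //.
- rewrite hd !natrD !natrM natrD natrM /M.
  have h : n%:R * (4 * b%:R + 4) <= 2 * a * (36 * X).
    by apply: ler_pM => //; lra.
  lra.
- apply: (@le_trans _ _ (2 * b * n)%:R); first by rewrite ler_nat.
  have hd0 : 0 <= log2 d%:R :> R.
    by rewrite /log2 divr_ge0 ?ln_ge0 // ler1n.
  have h : b%:R * n%:R <= 8 * X * (2 * a) by apply: ler_pM => //; lra.
  by rewrite !natrM /M; lra.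
Qed.
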